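(* Let $K$ be a field and let $I\subseteq K[x_1,\dots,x_n]$ be an arbitrary nonzero proper squarefree monomial ideal. Then $\rho(I)\le d(I)$.
   Context: $d(I)$ is the maximum degree of a minimal monomial generator of $I$. $I^{(h)}$ is the $h$-th symbolic power of $I$; for a squarefree monomial ideal, $I^{(h)}=\bigcap_{P\in\mathrm{Min}(I)}P^h$, where $\mathrm{Min}(I)$ is the set of minimal primes of $I$. The resurgence number of $I$ is $$\rho(I)=\sup\left\{\frac hk\ \middle|\ h,k\ge1\text{ integers},\ I^{(h)}\not\subseteq I^k\right\}.$$ *)

(* Defs.v *)
(* Mathematical Components with MathComp-Analysis (classical sets, extended
   reals).  [mpoly] must be imported before the MathComp-Analysis files: in the
   opposite order the two libraries' notations clash. *)
From HB Require Import structures.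
From mathcomp Require Import all_boot all_order all_algebra.
From mathcomp Require Import mpoly.
From mathcomp Require Import boolp classical_sets reals constructive_ereal ereal.

Set Implicit Arguments.
Unset Strict Implicit.
Unset Printing Implicit Defensive.

Import Order.TTheory GRing.Theory Num.Theory.
Local Open Scope classical_set_scope.
Local Open Scope ring_scope.

Section Ideals.
Variable A : comNzRingType.
Implicit Types (I J P : set A).

(* Unlike [idealr_closed], this does not force the ideal to be proper. *)
Definition is_ideal I : Prop :=
  I 0 /\ forall a u v, I u -> I v -> I (a * u + v).

Definition ideal_gen (S : set A) : set A := smallest is_ideal S.

Definition ideal_mul I J : set A :=
  ideal_gen [set u * v | u in I & v in J].

Definition ideal_pow I (k : nat) : set A := iter k (ideal_mul I) setT.

(* [idealr_closed] includes [1 \notin P]. *)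
Definition prime_ideal P : Prop :=
  idealr_closed [pred x in P] /\ prime_idealr_closed [pred x in P].

Definition min_primes I : set (set A) :=
  [set P | [/\ prime_ideal P, I `<=` P &
    forall Q, prime_ideal Q -> I `<=` Q -> Q `<=` P -> Q = P]].

(* The intersection of the powers of the minimal primes; this is the symbolic
   power of [I] when [I] is a squarefree monomial ideal, the only case in which
   it is used. *)
Definition symbolic_power I (h : nat) : set A :=
  \bigcap_(P in min_primes I) ideal_pow P h.

(* The supremum is taken in the extended reals, so that finiteness of the
   resurgence is not presupposed. *)
Definition resurgence (R : realType) I : \bar R :=
  ereal_sup [set x | exists h k : nat,
    [/\ (1 <= h)%N, (1 <= k)%N, ~ (symbolic_power I h `<=` ideal_pow I k) &
        x = (h%:R / k%:R)%:E]].

End Ideals.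

Section MonomialIdeals.
Variables (K : fieldType) (n : nat).
Implicit Types (I : set {mpoly K[n]}) (S G : set 'X_{1..n}) (m : 'X_{1..n}).

Definition monomial_ideal S : set {mpoly K[n]} :=
  ideal_gen [set 'X_[m] | m in S].

Definition squarefree m : Prop := forall i : 'I_n, (m i <= 1)%N.

Definition squarefree_monomial_ideal I : Prop :=
  exists S, (forall m, S m -> squarefree m) /\ I = monomial_ideal S.

Definition min_generating_set I G : Prop :=
  monomial_ideal G = I /\
  forall G', G' `<=` G -> monomial_ideal G' = I -> G' = G.

Definition min_generator I m : Prop :=
  exists G, min_generating_set I G /\ G m.

(* The value is the default 0 when there is no maximum, e.g. for the zero
   ideal. *)
Definition max_gen_deg I : nat :=
  xget 0%N [set d | (exists m, min_generator I m /\ mdeg m = d) /\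
                    (forall m, min_generator I m -> (mdeg m <= d)%N)].

End MonomialIdeals.

(* Main.v *)
(** Let [u] be a minimal generator of [I] dividing a monomial [m] of [I^(h)].
    The variables in a minimal vertex cover [C] generate a minimal prime of [I],
    so [m] has [C]-degree at least [h], and passing from [m] to [m / u] lowers
    the [C]-degree by at most [deg u <= d].  Since [I^(h)] is contained in [I]
    as soon as [0 < h], generators can be split off greedily: a monomial of
    [I^(h)] lies in [I^k] whenever [d (k - 1) < h]. *)
Require Import Defs.
From HB Require Import structures.
From mathcomp Require Import all_boot all_order all_algebra.
From mathcomp Require Import mpoly.
From mathcomp Require Import boolp classical_sets reals constructive_ereal ereal.
From mathcomp Require Import zify.

Set Implicit Arguments.
Unset Strict Implicit.
Unset Printing Implicit Defensive.

Import Order.TTheory GRing.Theory Num.Theory.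
Local Open Scope classical_set_scope.
Local Open Scope ring_scope.

(** * Ideals, their powers and primes in a commutative ring *)

Section IdealTheory.
Variable A : comNzRingType.
Implicit Types (I J P S : set A).

Lemma is_idealD I u v : is_ideal I -> I u -> I v -> I (u + v).
Proof. by case=> _ idI Iu Iv; rewrite -[u]mul1r; apply: idI. Qed.

Lemma is_idealMl I a u : is_ideal I -> I u -> I (a * u).
Proof. by case=> I0 idI Iu; rewrite -[_ * _]addr0; apply: idI. Qed.

Lemma is_ideal_sum I (T : eqType) (r : seq T) (F : T -> A) :
  is_ideal I -> (forall t, t \in r -> I (F t)) -> I (\sum_(t <- r) F t).
Proof.
move=> idI IF; rewrite big_seq; apply: big_ind => //; first by case: idI.
by move=> u v; apply: is_idealD.
Qed.

Lemma ideal_gen_is_ideal S : is_ideal (ideal_gen S).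
Proof.
split=> [J [[J0 _] _] //|a u v Iu Iv J [idJ SJ]].
by apply: idJ.2; [apply: Iu | apply: Iv].
Qed.

Lemma ideal_pow_is_ideal I k : is_ideal (ideal_pow I k).
Proof. by case: k => [//|k]; apply: ideal_gen_is_ideal. Qed.

Lemma ideal_powS I k u v : I u -> ideal_pow I k v -> ideal_pow I k.+1 (u * v).
Proof. by move=> Iu Iv; apply: sub_gen_smallest; exists u => //; exists v. Qed.

Lemma prime_ideal_is_ideal P : prime_ideal P -> is_ideal P.
Proof.
case=> [[P0 _ idP] _]; split=> [|a u v Pu Pv]; first by rewrite inE in P0.
by apply: set_mem; apply: idP; rewrite inE.
Qed.

Lemma prime_idealM P u v : prime_ideal P -> P (u * v) -> P u \/ P v.
Proof.
case=> _ primeP Puv; have := primeP u v; rewrite !inE => /(_ Puv) /orP.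
by case=> /set_mem; [left | right].
Qed.

Lemma prime_ideal_neq1 P : prime_ideal P -> ~ P 1.
Proof. by case=> [[_ P1 _] _] Q1; move: P1; rewrite inE mem_set. Qed.

(** [0 < k] records that [1] lies outside [P]; it later ensures that a variable found in [P] really
    divides the monomial at hand. *)
Lemma prime_idealX P u k : prime_ideal P -> P (u ^+ k) -> (0 < k)%N /\ P u.
Proof.
move=> primeP; elim: k => [/(prime_ideal_neq1 primeP)//|k IHk].
by rewrite exprS => /(prime_idealM primeP) [//|/IHk[]].
Qed.

Lemma prime_ideal_prod P (T : eqType) (r : seq T) (F : T -> A) :
  prime_ideal P -> P (\prod_(t <- r) F t) -> exists2 t, t \in r & P (F t).
Proof.
move=> primeP; elim: r => [|t r IHr].
  by rewrite big_nil => /(prime_ideal_neq1 primeP).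
rewrite big_cons => /(prime_idealM primeP) [Pt|/IHr[s sr Ps]].
  by exists t; rewrite ?mem_head.
by exists s; rewrite ?in_cons ?sr ?orbT.
Qed.

Lemma kernel_prime_ideal (B : idomainType) (f : {rmorphism A -> B}) :
  prime_ideal [set u | f u = 0].
Proof.
split; first split.
- by rewrite inE /= rmorph0.
- by apply/negP; rewrite inE /= rmorph1; apply/eqP/oner_neq0.
- move=> a u v; rewrite !inE /= => fu fv.
  by rewrite rmorphD rmorphM fu fv mulr0 addr0.
move=> u v; rewrite !inE /= => /eqP.
rewrite rmorphM mulf_eq0 => /orP[] /eqP f0; apply/orP; [left|right];
  exact: mem_set.
Qed.

End IdealTheory.

(** * Membership in monomial ideals *)

Section Monomials.
Variables (K : fieldType) (n : nat).
Implicit Types (I : set {mpoly K[n]}) (S G : set 'X_{1..n}) (m : 'X_{1..n}).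
Implicit Types (C D : {set 'I_n}) (f g : {mpoly K[n]}).

Lemma monomials_in_ideal I f : is_ideal I ->
  (forall m, m \in msupp f -> I 'X_[m]) -> I f.
Proof.
move=> idI If; rewrite (mpolyE f); apply: is_ideal_sum => // m /If Im.
by rewrite -mul_mpolyC; apply: (is_idealMl _ idI).
Qed.

(** Shaped after the closure condition of [is_ideal]: a condition on support monomials that passes
    to multiples defines an ideal. *)
Lemma msupp_combination a f g m : m \in msupp (a * f + g) ->
  (exists2 m', m' \in msupp f & (m' <= m)%MM) \/ m \in msupp g.
Proof.
move=> /msuppD_le; rewrite mem_cat => /orP[/msuppM_le|]; last by right.
by case/allpairsP=> -[m1 m2] /= [_ fm2 ->]; left; exists m2; rewrite ?lem_addl.
Qed.

Lemma monomial_idealP S f : monomial_ideal (K := K) S f <->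
  (forall m, m \in msupp f -> exists2 s, S s & (s <= m)%MM).
Proof.
split.
  pose J := [set f : {mpoly K[n]} |
    forall m, m \in msupp f -> exists2 s, S s & (s <= m)%MM].
  suff: monomial_ideal (K := K) S `<=` J by apply.
  apply: smallest_sub => [|_ [s Ss <-] m]; last first.
    by rewrite msuppX inE => /eqP ->; exists s; rewrite ?lepm_refl.
  split=> [m|a u v Ju Jv m]; first by rewrite msupp0.
  case/msupp_combination=> [[m' /Ju[s Ss ssm'] m'm]|/Jv//].
  by exists s => //; apply: lepm_trans m'm.
have idS : is_ideal (monomial_ideal (K := K) S) by apply: ideal_gen_is_ideal.
move=> Sf; apply: monomials_in_ideal => // m /Sf[s Ss /submK <-].
rewrite mpolyXD; apply: (is_idealMl _ idS).
by apply: (@sub_gen_smallest _ _ _ 'X_[s]); exists s.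
Qed.

Lemma monomial_idealXP S m :
  monomial_ideal (K := K) S 'X_[m] <-> exists2 s, S s & (s <= m)%MM.
Proof.
rewrite monomial_idealP; split=> [|Sm m']; first by apply; rewrite msuppX inE.
by rewrite msuppX inE => /eqP ->.
Qed.

Lemma monomial_ideal_msupp S f m :
  monomial_ideal (K := K) S f -> m \in msupp f ->
  monomial_ideal (K := K) S 'X_[m].
Proof. by move=> /monomial_idealP Sf /Sf; rewrite monomial_idealXP. Qed.

(** * Minimal generators and their maximal degree *)

Lemma lepm_mdeg m1 m2 : (m1 <= m2)%MM -> (mdeg m1 <= mdeg m2)%N.
Proof. by move=> /submK <-; rewrite mdegD leq_addl. Qed.

Lemma lepm_anti m1 m2 : (m1 <= m2)%MM -> (m2 <= m1)%MM -> m1 = m2.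
Proof.
move=> /mnm_lepP le12 /mnm_lepP le21; apply/mnmP => i.
by apply/eqP; rewrite eqn_leq le12 le21.
Qed.

Definition divisibility_minimal I : set 'X_{1..n} :=
  [set m | I 'X_[m] /\ forall m', I 'X_[m'] -> (m' <= m)%MM -> m' = m].

Lemma divisibility_minimal_exists I m : I 'X_[m] ->
  exists2 g, divisibility_minimal I g & (g <= m)%MM.
Proof.
have [k] := ubnP (mdeg m); elim: k m => // k IHk m ltmk Im.
have [minm|] := pselect (divisibility_minimal I m).
  by exists m; rewrite ?lepm_refl.
move=> /not_andP[//|/existsNP[m' /not_implyP[Im' /not_implyP[le_m'm ne_m'm]]]].
have lt_m' : (mdeg m' < mdeg m)%N.
  (* With equal degrees the cofactor [m - m'] would have degree 0, hence be trivial. *)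
  rewrite ltn_neqAle lepm_mdeg // andbT; apply/eqP => eqdeg; apply: ne_m'm.
  move/eqP: eqdeg; rewrite -{1}(submK le_m'm) mdegD -[X in X == _]add0n.
  by rewrite eqn_add2r eq_sym mdeg_eq0 => /eqP m0;
    rewrite -{1}(add0m m') -m0 submK.
have [g ming le_gm'] := IHk m' (leq_trans lt_m' ltmk) Im'.
by exists g => //; apply: lepm_trans le_m'm.
Qed.

(** A monomial of [I] minimal for divisibility has only itself as a divisor in [I], so no generating
    set can omit it. *)
Lemma divisibility_minimal_generating S (I := monomial_ideal (K := K) S) :
  min_generating_set I (divisibility_minimal I).
Proof.
have idI : is_ideal I by apply: ideal_gen_is_ideal.
have genI : monomial_ideal (K := K) (divisibility_minimal I) = I.
  apply/seteqP; split=> f.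
    move=> /monomial_idealP If; apply: monomials_in_ideal => // m.
    by move=> /If[s [Is _] /submK <-]; rewrite mpolyXD; apply: is_idealMl idI _.
  move=> If; apply/monomial_idealP => m /(monomial_ideal_msupp If).
  exact: divisibility_minimal_exists.
split=> // G sGmin genG; apply/seteqP; split=> // g [Ig ming].
move: (Ig); rewrite -genG => /monomial_idealXP[g' Gg' le_g'g].
by rewrite -(ming g') //; case: (sGmin _ Gg').
Qed.

(** Some [s] in [S] divides [m], and some [g] in [G] divides [s]. Either [g = m], which forces
    [s = m], or [g] makes [m] redundant in [G]. This transfers squarefreeness from [S] to the
    minimal generators. *)
Lemma min_generator_in_generators S m :
  min_generator (monomial_ideal (K := K) S) m -> S m.
Proof.
move=> [G [[genG minG] Gm]].
have /monomial_idealXP[s Ss le_sm] : monomial_ideal (K := K) S 'X_[m].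
  by rewrite -genG; apply/monomial_idealXP; exists m; rewrite ?lepm_refl.
have /monomial_idealXP[g Gg le_gs] : monomial_ideal (K := K) G 'X_[s].
  by rewrite genG; apply/monomial_idealXP; exists s; rewrite ?lepm_refl.
have [eq_gm|ne_gm] := eqVneq g m.
  by rewrite -(lepm_anti le_sm) // -eq_gm.
suff GDm : G `\ m = G by move: Gm; rewrite -GDm => -[_ /=].
apply: minG; first exact: subDsetl.
rewrite -genG; apply/seteqP; split=> f /monomial_idealP If;
  apply/monomial_idealP => p /If[t].
  by case=> Gt _ le_tp; exists t.
have [-> _ le_mp|/eqP ne_tm Gt le_tp] := eqVneq t m; last by exists t.
exists g; first by split=> //; apply/eqP.
exact: lepm_trans (lepm_trans le_gs le_sm) le_mp.
Qed.

Lemma squarefree_mdeg m : squarefree m -> (mdeg m <= n)%N.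
Proof.
move=> sqm; rewrite mdegE (leq_trans (leq_sum _ (fun i _ => sqm i))) //.
by rewrite sum1_card card_ord.
Qed.

(** Squarefree generators have degree at most [n], so the maximum exists and [max_gen_deg] does not
    fall back on its default. *)
Lemma mdeg_le_max_gen_deg S m (I := monomial_ideal (K := K) S) :
  (forall s, S s -> squarefree s) ->
  min_generator I m -> (mdeg m <= max_gen_deg I)%N.
Proof.
move=> sqS genm.
pose isdeg k := `[< exists m, min_generator I m /\ mdeg m = k >].
have exdeg : exists k, isdeg k by exists (mdeg m); apply/asboolP; exists m.
have ubdeg k : isdeg k -> (k <= n)%N.
  move=> /asboolP[p [genp <-]]; apply/squarefree_mdeg/sqS.
  exact: min_generator_in_generators.
have [d /asboolP degd maxd] := ex_maxnP exdeg ubdeg.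
rewrite /max_gen_deg; case: xgetP => [e _ [_ maxe]|nomax]; first exact: maxe.
case: (nomax d); split=> // p genp.
by apply: maxd; apply/asboolP; exists p.
Qed.

Lemma max_gen_deg_divisor S m (I := monomial_ideal (K := K) S) :
  (forall s, S s -> squarefree s) -> I 'X_[m] ->
  exists2 u, I 'X_[u] & (u <= m)%MM /\ (mdeg u <= max_gen_deg I)%N.
Proof.
move=> sqS /divisibility_minimal_exists[u minu le_um]; exists u.
  by case: minu.
split=> //; apply: mdeg_le_max_gen_deg => //; exists (divisibility_minimal I).
by split=> //; apply: divisibility_minimal_generating.
Qed.

(** * Degree on a set of variables, and primes generated by variables *)

Definition mdeg_on C m : nat := (\sum_(i in C) m i)%N.

Lemma mdeg_onD C m1 m2 : mdeg_on C (m1 + m2) = (mdeg_on C m1 + mdeg_on C m2)%N.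
Proof. by rewrite -big_split; apply: eq_bigr => i _; rewrite mnmDE. Qed.

Lemma mdeg_on_le C m : (mdeg_on C m <= mdeg m)%N.
Proof. by rewrite mdegE [leqRHS](bigID (mem C)) leq_addr. Qed.

Lemma mdeg_on_gt0P C m :
  reflect (exists2 i, i \in C & (0 < m i)%N) (0 < mdeg_on C m)%N.
Proof.
rewrite lt0n sum_nat_eq0 negb_forall.
apply: (iffP existsP) => -[i].
  by rewrite negb_imply -lt0n => /andP[]; exists i.
by move=> Ci mi; exists i; rewrite negb_imply Ci -lt0n.
Qed.

(* For [h = 1] this is the prime ideal generated by the variables in [C], and in
   general the [h]-th power of that prime. *)
Definition cover_ideal C (h : nat) : set {mpoly K[n]} :=
  [set f | forall m, m \in msupp f -> (h <= mdeg_on C m)%N].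

Lemma cover_ideal_is_ideal C h : is_ideal (cover_ideal C h).
Proof.
split=> [m|a u v Cu Cv m]; first by rewrite msupp0.
case/msupp_combination=> [[m' /Cu le_hm' /submK <-]|/Cv//].
by rewrite mdeg_onD (leq_trans le_hm') ?leq_addl.
Qed.

Lemma cover_ideal_pow C h : ideal_pow (cover_ideal C 1) h `<=` cover_ideal C h.
Proof.
elim: h => [f _ m //|h IHh]; apply: smallest_sub.
  exact: cover_ideal_is_ideal.
move=> _ [u Cu [v /IHh Cv <-]] m /msuppM_le /allpairsP[[m1 m2] /= [um1 vm2 ->]].
by rewrite mdeg_onD -add1n leq_add ?Cu ?Cv.
Qed.

Definition kill_variables C : n.-tuple {mpoly K[n]} :=
  [tuple if i \in C then 0 else 'X_i | i < n].

Lemma kill_variablesX C m :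
  'X_[m] \mPo kill_variables C = if (0 < mdeg_on C m)%N then 0 else 'X_[m].
Proof.
rewrite comp_mpolyX; case: mdeg_on_gt0P => [[i Ci mi]|noC].
  by rewrite (bigD1 i) //= tnth_mktuple Ci expr0n eqn0Ngt mi mul0r.
rewrite mpolyXE_id; apply: eq_bigr => i _; rewrite tnth_mktuple.
have [Ci|//] := boolP (i \in C).
have [->|mi] := posnP (m i); first by rewrite !expr0.
by case: noC; exists i.
Qed.

(** The substitution erases the monomials meeting [C] and fixes all others, so no cancellation can
    occur. Primality follows, since the target is a domain. *)
Lemma cover_ideal_kernel C :
  cover_ideal C 1 = [set f | f \mPo kill_variables C = 0].
Proof.
apply/seteqP; split=> f /=.
  move=> Cf; rewrite comp_mpolyEX big_seq big1 // => m /Cf Cm.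
  by rewrite kill_variablesX Cm scaler0.
move=> f0 m fm; rewrite lt0n; apply/negP => /eqP m0.
(* Compare coefficients at [m]: only the term of [m] itself contributes. *)
move/(congr1 (mcoeff m)): f0; rewrite mcoeff0 comp_mpolyEX raddf_sum /=.
rewrite (bigD1_seq m) ?msupp_uniq //= mcoeffZ kill_variablesX m0 /=.
rewrite mcoeffX eqxx mulr1 big1 => [/eqP|p ne_pm].
  by rewrite addr0 mcoeff_eq0 fm.
rewrite mcoeffZ kill_variablesX.
by case: ifP; rewrite ?mcoeff0 ?mcoeffX ?(negPf ne_pm) mulr0.
Qed.

Lemma cover_ideal_prime C : prime_ideal (cover_ideal C 1).
Proof.
rewrite cover_ideal_kernel.
exact: (kernel_prime_ideal (comp_mpoly (kill_variables C))).
Qed.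

(** * Vertex covers and minimal primes *)

(** Boolean, so that [minset] applies. Taking all monomials of [I] as edges gives the same covers as
    taking generators, since multiples of a covered monomial are covered. *)
Definition vertex_cover I : pred {set 'I_n} :=
  fun C => `[< forall m, I 'X_[m] -> (0 < mdeg_on C m)%N >].

(** A prime [Q] between [I] and the prime of [C] contains a variable of each monomial of [I]. The
    variables in [Q] thus form a cover inside [C], which is all of [C] by minimality. *)
Lemma minset_cover_min_primes S C (I := monomial_ideal (K := K) S) :
  minset (vertex_cover I) C -> min_primes I (cover_ideal C 1).
Proof.
move=> /minsetP[/asboolP coverC minC]; split; first exact: cover_ideal_prime.
  by move=> f If m /(monomial_ideal_msupp If); apply: coverC.
move=> Q primeQ sIQ sQC; apply/seteqP; split=> //.
pose D := [set i | `[< Q 'X_i >]]%SET.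
have inD i : (i \in D) = `[< Q 'X_i >] by rewrite inE.
have eqDC : D = C.
  apply: minC.
    apply/asboolP => m /sIQ; rewrite mpolyXE_id.
    case/(prime_ideal_prod primeQ) => i _ /(prime_idealX primeQ)[mi Qi].
    by apply/mdeg_on_gt0P; exists i; rewrite // inD; apply/asboolP.
  apply/fintype.subsetP => i; rewrite inD => /asboolP /sQC /(_ U_(i)%MM).
  rewrite msuppX inE eqxx => /(_ isT) /mdeg_on_gt0P[j Cj].
  by rewrite mnm1E; case: eqVneq => // ->.
have idQ := prime_ideal_is_ideal primeQ.
move=> f Cf; apply: monomials_in_ideal => // m /Cf /mdeg_on_gt0P[i].
rewrite -eqDC inD => /asboolP Qi mi.
have /submK <- : (U_(i) <= m)%MM by rewrite lep1mP -lt0n.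
by rewrite mpolyXD; apply: (is_idealMl _ idQ).
Qed.

Lemma symbolic_power_mdeg S h f m C (I := monomial_ideal (K := K) S) :
  symbolic_power I h f -> m \in msupp f ->
  minset (vertex_cover I) C -> (h <= mdeg_on C m)%N.
Proof.
move=> If fm /minset_cover_min_primes minC.
exact: (cover_ideal_pow (If _ minC)).
Qed.

(* If [X^m] is not in [I], the complement of the support of [m] is a cover; this
   is where squarefreeness is used. *)
Lemma cover_positive_in_ideal S m (I := monomial_ideal (K := K) S) :
  (forall s, S s -> squarefree s) ->
  (forall C, minset (vertex_cover I) C -> (0 < mdeg_on C m)%N) -> I 'X_[m].
Proof.
move=> sqS posm; apply: contrapT => nIm.
pose D := [set i | m i == 0%N]%SET.
have inD i : (i \in D) = (m i == 0%N) by rewrite inE.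
have coverD : vertex_cover I D.
  apply/asboolP => p /monomial_idealXP[s Ss /mnm_lepP le_sp].
  (* If [p] avoids [D], its divisor [s] is supported where [m] is positive; exponents of [s] being
     at most 1, [s] divides [m]. *)
  apply: contra_notT nIm => nDp.
  apply/monomial_idealXP; exists s => //; apply/mnm_lepP => i.
  have [mi|mi] := posnP (m i); last exact: leq_trans (sqS s Ss i) mi.
  rewrite mi; apply: contraNT nDp; rewrite -ltnNge => si.
  apply/mdeg_on_gt0P; exists i; first by rewrite inD mi.
  exact: leq_trans si (le_sp i).
have [C minC sCD] := minset_exists coverD.
have /mdeg_on_gt0P[i Ci] := posm C minC.
by move/(fintype.subsetP sCD): Ci; rewrite inD => /eqP ->.
Qed.

(** * Splitting off generators *)

(** Stating the hypothesis through degrees on covers lets the induction pass to the quotient by [u].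
    The bound is [d (k - 1) < h], written without truncated subtraction. *)
Lemma mdeg_on_ideal_pow S h k m (I := monomial_ideal (K := K) S)
    (d := max_gen_deg I) :
  (forall s, S s -> squarefree s) -> (d * k < h + d)%N ->
  (forall C, minset (vertex_cover I) C -> (h <= mdeg_on C m)%N) ->
  ideal_pow I k 'X_[m].
Proof.
move=> sqS; elim: k h m => // k IHk h m lt_dk le_h.
have h_gt0 : (0 < h)%N by lia.
have /(max_gen_deg_divisor sqS)[u Iu [le_um le_ud]] : I 'X_[m].
  by apply: cover_positive_in_ideal => // C /le_h; apply: leq_trans.
rewrite -(submK le_um) addmC mpolyXD; apply: ideal_powS => //.
(* Here [d * k < h]. If [h < d], the difference truncates to 0, and the required [d * k < d] still
   holds. *)
apply: (IHk (h - d)%N) => [|C /le_h]; first by rewrite -/d; lia.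
rewrite -{1}(submK le_um) mdeg_onD.
have := mdeg_on_le C u; rewrite -/d in le_ud *; lia.
Qed.

Lemma symbolic_power_sub_ideal_pow S h k (I := monomial_ideal (K := K) S)
    (d := max_gen_deg I) :
  (forall s, S s -> squarefree s) -> (d * k < h + d)%N ->
  symbolic_power I h `<=` ideal_pow I k.
Proof.
move=> sqS lt_dk f If; apply: monomials_in_ideal => [|m fm].
  exact: ideal_pow_is_ideal.
apply: mdeg_on_ideal_pow lt_dk _ => // C; exact: symbolic_power_mdeg If fm.
Qed.

End Monomials.

Theorem corollary3p6 (R : realType) (K : fieldType) (n : nat)
    (I : set {mpoly K[n]})
    (I_sqfree : squarefree_monomial_ideal I)
    (I_nonzero : I <> [set 0])
    (I_proper : I <> setT) :
  (resurgence R I <= (max_gen_deg I)%:R%:E)%E.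
Proof.
case: I_sqfree => S [sqS defI].
apply: ge_ereal_sup => _ [h [k [h_ge1 k_ge1 not_sub ->]]].
rewrite lee_fin ler_pdivrMr ?ltr0n // -natrM ler_nat leqNgt.
(* [d * k < h] implies the weaker [d * k < h + d], which already forces the containment. *)
apply/negP => lt_h; apply: not_sub; rewrite defI in lt_h *.
by apply: symbolic_power_sub_ideal_pow => //; lia.
Qed.
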